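(* Let $f:\mathbb{R}^d\to\mathbb{R}$ be twice differentiable with $L$-Lipschitz gradient and $M$-Lipschitz Hessian, uniformly bounded below by $\bar f$. Let $\delta\in(0,1)$, let $\epsilon>0$, and set $\epsilon_g=\epsilon$, $\epsilon_H=\sqrt{\epsilon M}$. Run the algorithm described in the context with $\alpha_k=|\hat\lambda_k|$ at every negative curvature step, where the inexact oracles satisfy at every iteration $k$ $$\|g_k-\nabla f(x_k)\|\le \tfrac13\max\{\epsilon_g,\|g_k\|\},\qquad \|H_k-\nabla^2 f(x_k)\|\le \tfrac29\epsilon_H,\qquad |\hat\lambda_k-\lambda_{\min}(H_k)|\le \tfrac19\epsilon_H .$$ Then one may take $\alpha=2L$ as the upper bound on the $\alpha_k$, and with probability at least $1-\delta$ the algorithm terminates within at most $n=2\frac{f(x_0)-\bar f}{R_\epsilon}+BK$ iterations, where $$R_\epsilon=\min\left(\frac{\epsilon_g^2}{6L},\frac{2\epsilon_H^3}{9M^2}\right),\qquad B=1+\frac{18\alpha L}{M\epsilon_g},\qquad C=2304\,\frac{M^2\alpha^2\epsilon_g^2}{\epsilon_H^6},$$ $$K=C\max\left\{\log\left(\frac1\delta\right),\ \log\left(4\,\frac{f(x_0)-\bar f}{R_\epsilon}\right),\ 2\log(2BC),\ 1\right\},$$ and, as $\epsilon\to0$, $R_\epsilon=O(\epsilon^2)$, $B=O(\epsilon^{-1})$, $C=O(\epsilon^{-1})$, hence $K=\tilde O(\epsilon^{-1})$ and $n=\tilde O(\epsilon^{-2})$.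
   Context: Norms are the Euclidean norm for vectors and the spectral norm for matrices; Lipschitz continuity of the Hessian is with respect to the spectral norm. $O(\cdot)$ and $\tilde O(\cdot)$ hide constants depending on $L$, $M$, $f(x_0)-\bar f$ and $\delta$; $\tilde O$ also hides factors polylogarithmic in $\epsilon$. Oracles: at the iterate $x_k$ the algorithm receives an approximate gradient $g_k\in\mathbb{R}^d$ and, if requested, a symmetric approximate Hessian $H_k\in\mathbb{R}^{d\times d}$ together with a unit vector $\hat p_k$ (approximate minimum eigenvector of $H_k$) and the value $\hat\lambda_k:=\hat p_k^T H_k\hat p_k$. The oracle outputs may themselves be random. Algorithm: inputs are $\epsilon_g,\epsilon_H>0$, Lipschitz constants $L,M>0$, an upper bound $\alpha\ge\epsilon_H$ on negative curvature stepsizes, and a (deterministic) $x_0\in\mathbb{R}^d$. For $k=0,1,2,\dots$: (i) if $\|g_k\|>\epsilon_g$, set $x_{k+1}=x_k-\frac1L g_k$ (gradient step); (ii) else if $\hat\lambda_k<-\epsilon_H$, choose $\alpha_k\in[\epsilon_H,\min(\alpha,|\hat\lambda_k|)]$ (here $\alpha_k=|\hat\lambda_k|$), then draw $\sigma_k\in\{+1,-1\}$ with probability $\frac12$ each, and set $x_{k+1}=x_k+\frac{2\alpha_k}{M}\sigma_k\hat p_k$ (negative curvature step); (iii) else terminate and return $x_k$. The draw $\sigma_k$ is independent of everything generated before it: all $\sigma_i$ with $i<k$, and all $x_i,g_i,H_i,\hat p_i,\hat\lambda_i,\alpha_i$ with $i\le k$. *)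

(* Defs.v *)
From HB Require Import structures.
From mathcomp Require Import all_boot all_order all_algebra.
From mathcomp Require Import all_classical all_reals all_analysis.

Set Implicit Arguments.
Unset Strict Implicit.
Unset Printing Implicit Defensive.

Import Order.TTheory GRing.Theory Num.Theory.
Import numFieldNormedType.Exports.

Local Open Scope classical_set_scope.
Local Open Scope ring_scope.

Section LinearAlgebra.
Context {R : realType} {d : nat}.

(* The library norm `|_| on matrices is the maximum of the entries. *)
Definition enorm (v : 'cV[R]_d) : R := Num.sqrt (\sum_i v i 0 ^+ 2).

Definition spectral_norm (A : 'M[R]_d) : R :=
  sup [set enorm (A *m v) | v in [set v | enorm v <= 1]].

(* Used for symmetric matrices only, where the set of eigenvalues is finite,
   nonempty when 0 < d, and the same for the row eigenvectors of [eigenvalue]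
   as for column eigenvectors. *)
Definition lambda_min (A : 'M[R]_d) : R := inf [set a : R | eigenvalue A a].

End LinearAlgebra.

Section Smoothness.
Context {R : realType} {d : nat}.
Variable f : 'cV[R]_d -> R.

Definition gradient (x : 'cV[R]_d) : 'cV[R]_d :=
  \col_i 'D_(delta_mx i 0) f x.

Definition hessian (x : 'cV[R]_d) : 'M[R]_d :=
  \matrix_(i, j) 'D_(delta_mx j 0) (fun y => gradient y i 0) x.

Definition twice_differentiable : Prop :=
  (forall x, differentiable f x) /\ (forall x, differentiable gradient x).

Definition lipschitz_gradient (L : R) : Prop :=
  forall x y, enorm (gradient x - gradient y) <= L * enorm (x - y).

Definition lipschitz_hessian (M : R) : Prop :=
  forall x y, spectral_norm (hessian x - hessian y) <= M * enorm (x - y).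

End Smoothness.

(* All processes are defined at every index and every outcome.  A value that
   the algorithm does not produce (anything after termination, and the oracle
   outputs [hess_oracle] and [eigvec_oracle] when they are not requested) is a
   placeholder: the predicates below constrain it by measurability only, and
   it may be taken constant.  The sign [sign k] is a coin that is available at
   every index but used only in a negative curvature step. *)
Record trajectory (R : realType) (d : nat) (T : Type) := Trajectory {
  iterate : nat -> T -> 'cV[R]_d ;
  grad_oracle : nat -> T -> 'cV[R]_d ;
  hess_oracle : nat -> T -> 'M[R]_d ;
  eigvec_oracle : nat -> T -> 'cV[R]_d ;
  sign : nat -> T -> R }.

Section Algorithm.
Context {R : realType} {d : nat} {T : Type}.
Variables (tr : trajectory R d T) (eps_g eps_H : R).

Definition lambda_hat (k : nat) (w : T) : R :=
  let p := eigvec_oracle tr k w in (p^T *m hess_oracle tr k w *m p) 0 0.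

Definition stepsize (k : nat) (w : T) : R := `|lambda_hat k w|.

Definition gradient_step (k : nat) (w : T) : bool :=
  eps_g < enorm (grad_oracle tr k w).

Definition curvature_step (k : nat) (w : T) : bool :=
  ~~ gradient_step k w && (lambda_hat k w < - eps_H).

Definition stops (k : nat) (w : T) : bool :=
  ~~ gradient_step k w && ~~ curvature_step k w.

Definition reached (k : nat) (w : T) : Prop :=
  forall j : nat, (j < k)%N -> ~~ stops j w.

(* Termination at iteration k: the point x_k is returned after k updates. *)
Definition terminates_at (k : nat) (w : T) : Prop :=
  reached k w /\ stops k w.

Definition follows_algorithm (x0 : 'cV[R]_d) (L M : R) : Prop :=
  (forall w, iterate tr 0%N w = x0) /\
  (forall k w, reached k w ->
    (gradient_step k w ->
       iterate tr k.+1 w = iterate tr k w - L^-1 *: grad_oracle tr k w) /\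
    (curvature_step k w ->
       iterate tr k.+1 w = iterate tr k w +
         (2 * stepsize k w / M * sign tr k w) *: eigvec_oracle tr k w)).

(* The Hessian oracle is queried exactly when the gradient test fails. *)
Definition inexact_oracles (f : 'cV[R]_d -> R) : Prop :=
  forall k w, reached k w ->
    let x := iterate tr k w in
    let g := grad_oracle tr k w in
    let H := hess_oracle tr k w in
    let p := eigvec_oracle tr k w in
    enorm (g - gradient f x) <= 3^-1 * Num.max eps_g (enorm g) /\
    (~~ gradient_step k w ->
       [/\ H^T = H,
           enorm p = 1,
           spectral_norm (H - hessian f x) <= 2 / 9 * eps_H &
           `|lambda_hat k w - lambda_min H| <= 9^-1 * eps_H]).

(* The scalar random variables generated before the k-th sign is drawn. *)
Inductive generated_before (k : nat) : (T -> R) -> Prop :=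
| Gen_sign (i : nat) of (i < k)%N :
    generated_before k (sign tr i)
| Gen_iterate (i : nat) (a : 'I_d) of (i <= k)%N :
    generated_before k (fun w => iterate tr i w a 0)
| Gen_grad (i : nat) (a : 'I_d) of (i <= k)%N :
    generated_before k (fun w => grad_oracle tr i w a 0)
| Gen_hess (i : nat) (a b : 'I_d) of (i <= k)%N :
    generated_before k (fun w => hess_oracle tr i w a b)
| Gen_eigvec (i : nat) (a : 'I_d) of (i <= k)%N :
    generated_before k (fun w => eigvec_oracle tr i w a 0)
| Gen_lambda_hat (i : nat) of (i <= k)%N :
    generated_before k (lambda_hat i)
| Gen_stepsize (i : nat) of (i <= k)%N :
    generated_before k (stepsize i).

Definition history (k : nat) : set (set T) :=
  <<s \bigcup_(h in generated_before k)
        preimage_set_system setT h measurable >>.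

End Algorithm.

Section RandomSigns.
Context {R : realType} {d : nat} {disp : measure_display}
  {T : measurableType disp}.
Variables (P : probability T R) (tr : trajectory R d T).

Definition measurable_trajectory : Prop :=
  forall k h, generated_before tr k h -> measurable_fun setT h.

Definition independent_of (F : set (set T)) (X : T -> R) : Prop :=
  forall (A : set T) (B : set R), F A -> measurable B ->
    P (A `&` X @^-1` B) = (P A * P (X @^-1` B))%E.

Definition fair_independent_signs : Prop :=
  forall k, [/\ forall w, sign tr k w = 1 \/ sign tr k w = - 1,
                P [set w | sign tr k w = 1] = (2^-1)%:E,
                P [set w | sign tr k w = - 1] = (2^-1)%:E &
                independent_of (history tr k) (sign tr k)].

End RandomSigns.

(* In the formulas below, gap stands for f x0 - fbar. *)
Section Complexity.
Context {R : realType}.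

Definition decrease_bound (L M eps_g eps_H : R) : R :=
  Num.min (eps_g ^+ 2 / (6 * L)) (2 * eps_H ^+ 3 / (9 * M ^+ 2)).

Definition B_const (L M alpha eps_g : R) : R :=
  1 + 18 * alpha * L / (M * eps_g).

Definition C_const (M alpha eps_g eps_H : R) : R :=
  2304 * (M ^+ 2 * alpha ^+ 2 * eps_g ^+ 2 / eps_H ^+ 6).

(* ln 0 = 0 in the library; for gap = 0 the entry ln (4 * gap / _) is then
   below the entry 1, as the value -oo would be. *)
Definition K_const (L M alpha gap delta eps_g eps_H : R) : R :=
  let B := B_const L M alpha eps_g in
  let C := C_const M alpha eps_g eps_H in
  C * Num.max (ln (1 / delta))
     (Num.max (ln (4 * (gap / decrease_bound L M eps_g eps_H)))
     (Num.max (2 * ln (2 * B * C)) 1)).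

Definition iteration_bound (L M alpha gap delta eps_g eps_H : R) : R :=
  2 * (gap / decrease_bound L M eps_g eps_H) +
  B_const L M alpha eps_g * K_const L M alpha gap delta eps_g eps_H.

Definition bigO_at0 (F G : R -> R) : Prop := F =O_ (0^'+) G.

Definition softO_at0 (F G : R -> R) : Prop :=
  exists m : nat, bigO_at0 F (fun eps => G eps * `|ln eps| ^+ m).

End Complexity.

(* Main.v *)
(* An exponential supermartingale. While the algorithm runs, a gradient step
   decreases f by at least eps_g^2/(6L) >= R_eps, and a negative curvature step
   of size a = |lambda_hat| gives
     f(x_{k+1}) <= f(x_k) + sigma_k (2a/M) <grad f(x_k), p_k> - (2/9) a^3/M^2,
   where the random slope term is fair and |<grad f(x_k), p_k>| <= (4/3) eps_g.
   Since a >= eps_H, cosh y <= exp(2 y^2) absorbs the slope term into half of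
   the decrease once theta = eps_H / (128 eps_g^2).  Hence
     E[exp(theta (f(x_k) - fbar)); k-th iterate reached]
   shrinks by the factor exp(- theta R_eps / 2) at each step, so that
     P(k-th iterate reached) <= exp(theta (f(x_0) - fbar) - k theta R_eps / 2),
   which is at most delta for k >= n because B C theta R_eps / 2 >= 1 whenever
   eps_H <= 2L.  If eps_H > 2L there is no negative curvature step at all, and
   the decrease of f is deterministic. *)
Require Import Defs.
From HB Require Import structures.
From mathcomp Require Import all_boot all_order all_algebra.
From mathcomp Require Import all_classical all_reals all_analysis.
From mathcomp Require Import measurable_realfun.
From mathcomp Require Import ring lra.

Set Implicit Arguments.
Unset Strict Implicit.
Unset Printing Implicit Defensive.

Import Order.TTheory GRing.Theory Num.Theory.
Import numFieldNormedType.Exports.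

Local Open Scope classical_set_scope.
Local Open Scope ring_scope.

(** * Taylor bounds for functions with Lipschitz derivatives *)

Definition dot {R : realType} {d : nat} (u v : 'cV[R]_d) : R :=
  \sum_i u i 0 * v i 0.

Lemma dotC (R : realType) (d : nat) (u v : 'cV[R]_d) : dot u v = dot v u.
Proof. by apply: eq_bigr => i _; rewrite mulrC. Qed.

Lemma dotDl (R : realType) (d : nat) (u v w : 'cV[R]_d) :
  dot (u + v) w = dot u w + dot v w.
Proof. by rewrite -big_split; apply: eq_bigr => i _; rewrite mxE mulrDl. Qed.

Lemma dotZl (R : realType) (d : nat) (a : R) (u v : 'cV[R]_d) :
  dot (a *: u) v = a * dot u v.
Proof. by rewrite mulr_sumr; apply: eq_bigr => i _; rewrite mxE mulrA. Qed.

Lemma dotZr (R : realType) (d : nat) (a : R) (u v : 'cV[R]_d) :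
  dot u (a *: v) = a * dot u v.
Proof. by rewrite dotC dotZl dotC. Qed.

Lemma dotNl (R : realType) (d : nat) (u v : 'cV[R]_d) : dot (- u) v = - dot u v.
Proof. by rewrite -scaleN1r dotZl mulN1r. Qed.

Lemma dotBl (R : realType) (d : nat) (u v w : 'cV[R]_d) :
  dot (u - v) w = dot u w - dot v w.
Proof. by rewrite dotDl dotNl. Qed.

Lemma dotBr (R : realType) (d : nat) (u v w : 'cV[R]_d) :
  dot u (v - w) = dot u v - dot u w.
Proof. by rewrite dotC dotBl !(dotC _ u). Qed.

Lemma dotvv_ge0 (R : realType) (d : nat) (u : 'cV[R]_d) : 0 <= dot u u.
Proof. by apply: sumr_ge0 => i _; rewrite -expr2 sqr_ge0. Qed.

Lemma enorm_ge0 (R : realType) (d : nat) (u : 'cV[R]_d) : 0 <= enorm u.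
Proof. exact: sqrtr_ge0. Qed.

Lemma dotvvE (R : realType) (d : nat) (u : 'cV[R]_d) : dot u u = enorm u ^+ 2.
Proof.
rewrite /enorm sqr_sqrtr; first by apply: eq_bigr => i _; rewrite expr2.
by apply: sumr_ge0 => i _; rewrite sqr_ge0.
Qed.

Lemma enormZ (R : realType) (d : nat) (a : R) (u : 'cV[R]_d) :
  enorm (a *: u) = `|a| * enorm u.
Proof.
apply: (@pexpIrn _ 2) => //; rewrite ?nnegrE ?mulr_ge0 ?enorm_ge0//.
rewrite -dotvvE dotZl dotZr exprMn -dotvvE real_normK ?num_real//.
by rewrite expr2 mulrA.
Qed.

(** Cauchy-Schwarz: the squared norm of [dot v v *: u - dot u v *: v] is nonnegative and equals
    [b * (a * b - c ^+ 2)], with [a], [b], [c] as set in the proof. *)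
Lemma ler_dot (R : realType) (d : nat) (u v : 'cV[R]_d) :
  `|dot u v| <= enorm u * enorm v.
Proof.
rewrite -(@ler_pXn2r _ 2)// ?nnegrE ?mulr_ge0 ?enorm_ge0//.
rewrite real_normK ?num_real// exprMn -!dotvvE.
have := dotvv_ge0 (dot v v *: u - dot u v *: v).
rewrite dotBl !dotBr !dotZl !dotZr (dotC v u).
set a := dot u u; set b := dot v v; set c := dot u v => H.
have {}H : 0 <= b * (a * b - c ^+ 2) by nra.
have := dotvv_ge0 v; rewrite -/b le_eqVlt => /predU1P[b0|b_gt0]; last first.
  by rewrite -subr_ge0; rewrite pmulr_rge0 in H.
(* Here [b = 0] cannot be cancelled; instead every entry of [v] vanishes. *)
suff -> : c = 0 by rewrite expr0n mulr_ge0 ?dotvv_ge0.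
apply: big1 => i _; suff -> : v i 0 = 0 by rewrite mulr0.
have /psumr_eq0P : dot v v = 0 by [].
move=> /(_ (fun i _ => ltac:(by rewrite -expr2 sqr_ge0)) i isT) /eqP.
by rewrite mulf_eq0 orbb => /eqP.
Qed.

Lemma mulmx_colE (R : realType) (d : nat) (A : 'M[R]_d) (v : 'cV[R]_d) i :
  (A *m v) i 0 = dot (row i A)^T v.
Proof. by rewrite mxE; apply: eq_bigr => j _; rewrite !mxE. Qed.

Lemma quad_formE (R : realType) (d : nat) (A : 'M[R]_d) (v : 'cV[R]_d) :
  (v^T *m A *m v) 0 0 = dot v (A *m v).
Proof. by rewrite -mulmxA mxE; apply: eq_bigr => j _; rewrite mxE. Qed.

Lemma enorm_mulmx_le (R : realType) (d : nat) (A : 'M[R]_d) (v : 'cV[R]_d) :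
  enorm v <= 1 -> enorm (A *m v) <= spectral_norm A.
Proof.
move=> v1; apply: ub_le_sup; last by exists v.
(* A supremum bounds its set only if the set is bounded above. The Frobenius norm is such a bound,
   by Cauchy-Schwarz on each row. *)
exists (Num.sqrt (\sum_i enorm (row i A)^T ^+ 2)) => _ [u /= u1 <-].
rewrite ler_sqrt; last by apply: sumr_ge0 => i _; rewrite sqr_ge0.
apply: ler_sum => i _; rewrite mulmx_colE -real_normK ?num_real//.
rewrite ler_pXn2r ?nnegrE ?enorm_ge0// (le_trans (ler_dot _ _))//.
by rewrite ler_piMr ?enorm_ge0.
Qed.

Lemma quad_form_le (R : realType) (d : nat) (A : 'M[R]_d) (p : 'cV[R]_d) :
  enorm p = 1 -> `|dot p (A *m p)| <= spectral_norm A.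
Proof.
move=> p1; rewrite (le_trans (ler_dot _ _))// p1 mul1r.
by apply: enorm_mulmx_le; rewrite p1.
Qed.

(** The difference quotient in [s] is that of [f] at [x + t *: v] in the direction [v]; linearity of
    the differential, with [v] expanded in the canonical basis, turns its limit into the pairing
    with the gradient. *)
Lemma is_derive_line (R : realType) (d : nat) (f : 'cV[R]_d -> R)
    (x v : 'cV[R]_d) (t : R) :
  differentiable f (x + t *: v) ->
  is_derive t 1 (fun s => f (x + s *: v)) (dot (gradient f (x + t *: v)) v).
Proof.
move=> df.
have eqg : (fun h : R => h^-1 *: (f (x + (h *: 1 + t) *: v) - f (x + t *: v)))
  = (fun h => h^-1 *: (f (h *: v + (x + t *: v)) - f (x + t *: v))).
  by apply/funext => h; rewrite scalerDl [h *: 1]mulr1 addrCA.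
have dv : derivable f (x + t *: v) v by exact: diff_derivable.
split; first by rewrite /derivable eqg.
rewrite /derive eqg -/(derive f (x + t *: v) v) deriveE//.
have Ev : v = \sum_i v i 0 *: delta_mx i 0.
  by rewrite {1}[v]matrix_sum_delta; apply: eq_bigr => i _; rewrite big_ord1.
move: (x + t *: v) df {eqg dv} => a df; rewrite [X in 'd f a X]Ev linear_sum.
apply: eq_bigr => i _.
by rewrite linearZ/= mxE deriveE//; exact: mulrC.
Qed.

(** Row [i] of the Hessian is the gradient of the [i]-th partial derivative, so [is_derive_line]
    applies to each component. *)
Lemma is_derive_gradient_line (R : realType) (d : nat) (f : 'cV[R]_d -> R)
    (x v : 'cV[R]_d) (t : R) :
  twice_differentiable f ->
  is_derive t 1 (fun s => dot (gradient f (x + s *: v)) v)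
    (dot v (hessian f (x + t *: v) *m v)).
Proof.
move=> [_ dg].
have dgi i y : differentiable (fun z => gradient f z i 0) y.
  apply: differentiable_comp (differentiable_coord _ _ _); exact: dg.
pose h i s := v i 0 *: gradient f (x + s *: v) i 0.
have -> : (fun s => dot (gradient f (x + s *: v)) v) = \sum_i h i.
  by apply/funext => s; rewrite fct_sumE; apply: eq_bigr => i _; rewrite mulrC.
have -> : dot v (hessian f (x + t *: v) *m v) =
    \sum_i v i 0 *: dot (gradient (fun z => gradient f z i 0) (x + t *: v)) v.
  apply: eq_bigr => i _; rewrite mxE; congr (_ * _).
  by apply: eq_bigr => j _; rewrite !mxE.
apply: is_derive_sum => i.
apply: is_deriveZ; exact: is_derive_line.
Qed.

Lemma le_of_derive_le0 (R : realType) (g dg : R -> R) (c : R) :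
  0 <= c -> (forall t, is_derive t (1 : R) g (dg t)) ->
  (forall t, 0 <= t <= c -> dg t <= 0) -> g c <= g 0.
Proof.
move=> c0 gdg dg0.
have [|t tc] := @MVT_segment R g dg 0 c c0 (fun t _ => gdg t).
  apply: continuous_subspaceT => t; apply: differentiable_continuous.
  by apply/derivable1_diffP; have [] := gdg t.
rewrite in_itv/= in tc => E; rewrite -subr_le0 E.
by rewrite mulr_le0_ge0 ?subr0// dg0.
Qed.

(** Along the segment, [f] minus its quadratic majorant has derivative at most 0 by Cauchy-Schwarz
    and the Lipschitz bound, so it does not increase from 0 to 1. *)
Lemma descent_lemma (R : realType) (d : nat) (f : 'cV[R]_d -> R) (L : R)
    (x v : 'cV[R]_d) :
  twice_differentiable f -> lipschitz_gradient f L ->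
  f (x + v) <= f x + dot (gradient f x) v + L / 2 * enorm v ^+ 2.
Proof.
move=> [df _] lip.
pose a := dot (gradient f x) v; pose b := L / 2 * enorm v ^+ 2.
pose g t := f (x + t *: v) - (a * t + b * t ^+ 2).
pose dg t := dot (gradient f (x + t *: v)) v - (a + b * (2 * t)).
suff : g 1 <= g 0.
  by rewrite /g scale1r scale0r addr0 /a /b; lra.
apply: (@le_of_derive_le0 _ g dg) => // t.
  have ? := is_derive_line (df (x + t *: v)).
  by apply: is_derive_eq; rewrite /dg /GRing.scale/= !mulr1; lra.
move=> /andP[t0 _].
have := ler_dot (gradient f (x + t *: v) - gradient f x) v.
rewrite dotBl ler_norml => /andP[_].
have := lip (x + t *: v) x.
have -> : x + t *: v - x = t *: v by rewrite addrAC subrr add0r.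
rewrite enormZ ger0_norm//.
move=> /(ler_wpM2r (enorm_ge0 v)).
by rewrite /dg /a /b; lra.
Qed.

(** The monotonicity argument is used twice: the Lipschitz Hessian bounds the slope along the line
    by a quadratic ([h]), and this bounds [f] by a cubic ([g]). *)
Lemma cubic_descent_lemma (R : realType) (d : nat) (f : 'cV[R]_d -> R) (M : R)
    (x p : 'cV[R]_d) (c : R) :
  twice_differentiable f -> lipschitz_hessian f M -> enorm p = 1 -> 0 <= c ->
  f (x + c *: p) <= f x + c * dot (gradient f x) p +
    c ^+ 2 / 2 * dot p (hessian f x *m p) + M / 6 * c ^+ 3.
Proof.
move=> f2 lip p1 c0.
pose a := dot (gradient f x) p; pose b := dot p (hessian f x *m p).
pose h t := dot (gradient f (x + t *: p)) p - (a + b * t + M / 2 * t ^+ 2).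
pose dh t := dot p (hessian f (x + t *: p) *m p) - (b + M * t).
have h_le0 t : 0 <= t -> h t <= 0.
  move=> t0; have <- : h 0 = 0 by rewrite /h scale0r addr0 /a; lra.
  apply: (@le_of_derive_le0 _ h dh) => // s.
    have ? := is_derive_gradient_line x p s f2.
    by apply: is_derive_eq; rewrite /dh /GRing.scale/= !mulr1; lra.
  move=> /andP[s0 _].
  have Hs : spectral_norm (hessian f (x + s *: p) - hessian f x) <= M * s.
    have := lip (x + s *: p) x.
    have -> : x + s *: p - x = s *: p by rewrite addrAC subrr add0r.
    by rewrite enormZ p1 ger0_norm// mulr1.
  have := le_trans (quad_form_le (hessian f (x + s *: p) - hessian f x) p1) Hs.
  rewrite mulmxBl dotBr ler_norml => /andP[_].
  by rewrite /dh subr_le0 lerBlDl.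
pose g t := f (x + t *: p) - (a * t + b / 2 * t ^+ 2 + M / 6 * t ^+ 3).
suff : g c <= g 0.
  by rewrite /g scale0r addr0 /a /b; lra.
apply: (@le_of_derive_le0 _ g h) => // t; last first.
  by case/andP => ? _; exact: h_le0.
have ? := is_derive_line (f2.1 (x + t *: p)).
by apply: is_derive_eq; rewrite /h /GRing.scale/= !mulr1; lra.
Qed.

(** Along a unit direction the slope of [f] falls at rate at most [L]. Adding [(L + e) * t]
    therefore gives a strictly increasing function, whose derivative at 0 is nonnegative; [e] is
    arbitrary. *)
Lemma hessian_quad_ge (R : realType) (d : nat) (f : 'cV[R]_d -> R) (L : R)
    (x p : 'cV[R]_d) :
  twice_differentiable f -> lipschitz_gradient f L -> enorm p = 1 ->
  - L <= dot p (hessian f x *m p).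
Proof.
move=> f2 lip p1; apply/ler_addgt0Pr => e e0.
pose h t := dot (gradient f (x + t *: p)) p + (L + e) * t.
have dh t : is_derive t (1 : R) h
    (dot p (hessian f (x + t *: p) *m p) + (L + e)).
  have ? := is_derive_gradient_line x p t f2.
  by apply: is_derive_eq; rewrite /GRing.scale/= !mulr1.
have incrh : {homo h : s t / s < t}.
  move=> s t st.
  have := ler_dot (gradient f (x + t *: p) - gradient f (x + s *: p)) p.
  rewrite dotBl ler_norml p1 mulr1 => /andP[+ _].
  have := lip (x + t *: p) (x + s *: p).
  have -> : x + t *: p - (x + s *: p) = (t - s) *: p.
    by rewrite opprD addrACA subrr add0r scalerBl.
  rewrite enormZ p1 mulr1.
  rewrite gtr0_norm ?subr_gt0//.
  have : 0 < e * (t - s) by rewrite mulr_gt0 ?subr_gt0.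
  by rewrite /h; lra.
have : 0 <= derive1 h 0.
  apply: (@incr_derive1_ge0_itv R h true true (- 1) 1 0).
  - by move=> t _; have [] := dh t.
  - by move=> s t _ _; exact: incrh.
  - by rewrite in_itv/= ltrN10 ltr01.
rewrite derive1E (@derive_val _ _ _ _ _ _ _ (dh 0)) scale0r addr0; lra.
Qed.

(** * One step of the algorithm *)

(* The constant 2, instead of the optimal 1/2, allows a proof from
   [1 + y <= expR y] alone. *)
Lemma expR_cosh_le (R : realType) (y : R) :
  expR y + expR (- y) <= 2 * expR (2 * y ^+ 2).
Proof.
wlog y0 : y / 0 <= y.
  move=> H; have [/H//|/ltW] := leP 0 y.
  by rewrite -oppr_ge0 => /H; rewrite opprK sqrrN addrC.
have [y2|y2] := leP y 2^-1.
  (* [1 - y <= expR (- y)] and [1 + y <= expR y] bound both exponentials. After multiplication by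
     [1 - y ^+ 2] their sum is at most 2, while [(1 + 2 * y ^+ 2) * (1 - y ^+ 2) >= 1] for such
     [y]. *)
  have e1 : expR y * (1 - y) <= 1.
    rewrite -[leRHS](expRxMexpNx_1 y) ler_wpM2l ?expR_ge0// expR_ge1Dx//.
  have e2 : expR (- y) * (1 + y) <= 1.
    rewrite -[leRHS](expRxMexpNx_1 y) mulrC ler_wpM2r ?expR_ge0// expR_ge1Dx//.
  have e3 := expR_ge1Dx (2 * y ^+ 2).
  have y21 : y ^+ 2 <= 4^-1 by nra.
  have {}e1 : expR y * (1 - y ^+ 2) <= 1 + y by nra.
  have {}e2 : expR (- y) * (1 - y ^+ 2) <= 1 - y by nra.
  have : (expR y + expR (- y)) * (1 - y ^+ 2) <=
         2 * expR (2 * y ^+ 2) * (1 - y ^+ 2) by nra.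
  by rewrite ler_pM2r//; lra.
(* For [y > 1/2] one has [y <= 2 * y ^+ 2], so each exponential separately is below the bound. *)
have : expR (- y) <= expR y by rewrite ler_expR; lra.
have : expR y <= expR (2 * y ^+ 2) by rewrite ler_expR; nra.
lra.
Qed.

(** The error is at most a third of [enorm g], so the first-order gain is at least
    [2/3 * enorm g ^+ 2 / L]; the quadratic term costs half of [enorm g ^+ 2 / L], which leaves the
    factor 1/6. *)
Lemma gradient_step_decrease (R : realType) (d : nat) (f : 'cV[R]_d -> R)
    (L eg : R) (x g : 'cV[R]_d) :
  twice_differentiable f -> lipschitz_gradient f L -> 0 < L -> 0 < eg ->
  enorm (g - gradient f x) <= 3^-1 * Num.max eg (enorm g) -> eg < enorm g ->
  f (x - L^-1 *: g) <= f x - eg ^+ 2 / (6 * L).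
Proof.
move=> f2 lip L0 eg0 + gg; rewrite max_r ?(ltW gg)// => err.
apply: (le_trans (descent_lemma x (- (L^-1 *: g)) f2 lip)).
have g0 : 0 < enorm g by apply: lt_trans gg.
rewrite -scaleNr enormZ dotZr normrN ger0_norm ?invr_ge0 ?(ltW L0)//.
have dg : 2 / 3 * enorm g ^+ 2 <= dot (gradient f x) g.
  have := ler_dot (g - gradient f x) g; rewrite dotBl ler_norml => /andP[_].
  by rewrite dotvvE; move: err => /(ler_wpM2r (ltW g0)); lra.
have Li : L * L^-1 = 1 by rewrite mulfV ?gt_eqF.
have Li0 : 0 < L^-1 by rewrite invr_gt0.
have E1 : L / 2 * (L^-1 * enorm g) ^+ 2 = L^-1 / 2 * enorm g ^+ 2.
  by field; rewrite gt_eqF.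
have E2 : eg ^+ 2 / (6 * L) = L^-1 / 6 * eg ^+ 2 by field; rewrite gt_eqF.
rewrite E1 E2.
have : eg ^+ 2 <= enorm g ^+ 2 by rewrite ler_pXn2r ?nnegrE ?ltW.
by move=> /(ler_wpM2l (ltW Li0)); move: dg => /(ler_wpM2l (ltW Li0)); lra.
Qed.

Lemma gradient_dot_le (R : realType) (d : nat) (eg : R) (g h p : 'cV[R]_d) :
  enorm (g - h) <= 3^-1 * Num.max eg (enorm g) -> enorm g <= eg ->
  enorm p = 1 -> `|dot h p| <= 4 / 3 * eg.
Proof.
move=> + gg p1; rewrite max_l// => err.
have := ler_dot g p; have := ler_dot (g - h) p; rewrite p1 !mulr1.
by rewrite dotBl !ler_norml; lra.
Qed.

(** Since [eH < |lam|], the true curvature along [p] is at most [lam + 2/9 * eH <= - 7/9 * |lam|].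
    In units of [|lam| ^+ 3 / M ^+ 2] the quadratic term is then at most -14/9 and the cubic one is
    12/9. The sign is absorbed into the unit vector [s *: p]. *)
Lemma curvature_step_le (R : realType) (d : nat) (f : 'cV[R]_d -> R)
    (M eH s : R) (x p : 'cV[R]_d) (H : 'M[R]_d) :
  let lam := (p^T *m H *m p) 0 0 in
  twice_differentiable f -> lipschitz_hessian f M -> 0 < M -> 0 < eH ->
  enorm p = 1 -> spectral_norm (H - hessian f x) <= 2 / 9 * eH ->
  lam < - eH -> s = 1 \/ s = - 1 ->
  f (x + (2 * `|lam| / M * s) *: p) <=
    f x + s * (2 * `|lam| / M * dot (gradient f x) p)
    - 2 / 9 * `|lam| ^+ 3 / M ^+ 2.
Proof.
move=> lam f2 lip M0 eH0 p1 errH lamH s1.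
have sn : `|s| = 1 by case: s1 => ->; rewrite ?normrN normr1.
have ss : s * s = 1 by case: s1 => ->; rewrite ?mulrNN mulr1.
have lam0 : lam < 0 by lra.
have al : `|lam| = - lam by rewrite ltr0_norm.
have sp1 : enorm (s *: p) = 1 by rewrite enormZ sn mul1r.
have c0 : 0 <= 2 * `|lam| / M by rewrite divr_ge0 ?mulr_ge0// ltW.
rewrite -scalerA; apply: (le_trans (cubic_descent_lemma _ f2 lip sp1 c0)).
have -> : dot (s *: p) (hessian f x *m (s *: p)) = dot p (hessian f x *m p).
  by rewrite -scalemxAr dotZl dotZr mulrA ss mul1r.
rewrite dotZr.
have q : dot p (hessian f x *m p) <= - (7 / 9) * `|lam|.
  have := le_trans (quad_form_le (H - hessian f x) p1) errH.
  rewrite mulmxBl dotBr -(quad_formE H p) -/lam ler_norml.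
  by rewrite al; lra.
set a := `|lam| in q *; set y := dot (gradient f x) p.
have a0 : 0 <= a by rewrite normr_ge0.
have -> : M / 6 * (2 * a / M) ^+ 3 = 4 / 3 * a ^+ 3 / M ^+ 2.
  by field; rewrite gt_eqF.
have k0 : 0 <= (2 * a / M) ^+ 2 / 2 by rewrite divr_ge0 ?sqr_ge0.
have := ler_wpM2l k0 q.
have -> : (2 * a / M) ^+ 2 / 2 * (- (7 / 9) * a) = - (14 / 9) * a ^+ 3 / M ^+ 2.
  by field; rewrite gt_eqF.
by move: (a ^+ 3 / M ^+ 2) => z; lra.
Qed.

(** Curvature is at least [- L], hence [|lam| <= L + 2/9 * eH < L + 2/9 * |lam|], that is
    [|lam| < 9/7 * L]. *)
Lemma curvature_stepsize_le (R : realType) (d : nat) (f : 'cV[R]_d -> R)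
    (L eH : R) (x p : 'cV[R]_d) (H : 'M[R]_d) :
  let lam := (p^T *m H *m p) 0 0 in
  twice_differentiable f -> lipschitz_gradient f L -> 0 < L -> 0 < eH ->
  enorm p = 1 -> spectral_norm (H - hessian f x) <= 2 / 9 * eH ->
  lam < - eH -> `|lam| <= 2 * L.
Proof.
move=> lam f2 lip L0 eH0 p1 errH lamH.
rewrite ltr0_norm; last by lra.
have := hessian_quad_ge x f2 lip p1.
have := le_trans (quad_form_le (H - hessian f x) p1) errH.
rewrite mulmxBl dotBr -(quad_formE H p) -/lam ler_norml.
lra.
Qed.

(** Summing over the two signs gives a hyperbolic cosine of the slope term [z]. One half of the
    decrease [c] absorbs the resulting [2 * z ^+ 2]; the other half still exceeds [th * r / 2]. *)
Lemma curvature_step_mgf (R : realType) (M eg eH r a y v th : R) :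
  0 < M -> 0 < eg -> 0 < eH -> eH <= a -> `|y| <= 4 / 3 * eg ->
  r <= 2 * eH ^+ 3 / (9 * M ^+ 2) ->
  th = eH / (128 * eg ^+ 2) ->
  expR (th * (v + 1 * (2 * a / M * y) - 2 / 9 * a ^+ 3 / M ^+ 2)) +
  expR (th * (v + - 1 * (2 * a / M * y) - 2 / 9 * a ^+ 3 / M ^+ 2)) <=
    2 * (expR (- (th * r / 2)) * expR (th * v)).
Proof.
move=> M0 eg0 eH0 eHa yeg rle thE.
have th0 : 0 < th by rewrite thE divr_gt0 ?mulr_gt0 ?exprn_gt0.
have a0 : 0 < a by lra.
pose z := th * (2 * a / M * y); pose c := th * (2 / 9 * a ^+ 3 / M ^+ 2).
rewrite [th * (v + 1 * _ - _)](_ : _ = z + (th * v - c)); last first.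
  by rewrite /z /c; lra.
rewrite [th * (v + - 1 * _ - _)](_ : _ = - z + (th * v - c)); last first.
  by rewrite /z /c; lra.
rewrite !expRD -mulrDl.
apply: le_trans (ler_wpM2r _ (expR_cosh_le z)) _.
  by rewrite mulr_ge0 ?expR_ge0.
rewrite -[leLHS]mulrA ler_wpM2l// -!expRD ler_expR.
suff : 2 * z ^+ 2 - c <= - (th * r / 2) by lra.
have zc : 2 * z ^+ 2 <= c / 2.
  have y2 : y ^+ 2 <= (4 / 3 * eg) ^+ 2.
    by rewrite -real_normK ?num_real// ler_pXn2r ?nnegrE// mulr_ge0 ?(ltW eg0).
  have M_neq0 : M != 0 by rewrite gt_eqF.
  have -> : c / 2 = th * a ^+ 2 / M ^+ 2 * (a / 9) by rewrite /c; field.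
  have -> : 2 * z ^+ 2 = th * a ^+ 2 / M ^+ 2 * (8 * th * y ^+ 2).
    by rewrite /z; field.
  apply: ler_wpM2l.
    by rewrite divr_ge0 ?mulr_ge0 ?exprn_ge0 ?(ltW th0) ?(ltW a0) ?(ltW M0).
  apply: (@le_trans _ _ (8 * th * (4 / 3 * eg) ^+ 2)).
    by rewrite ler_wpM2l// mulr_ge0 ?(ltW th0).
  (* This identity dictates the value of [th]: the slope term costs exactly [eH / 9], which is at
     most [a / 9]. *)
  have -> : 8 * th * (4 / 3 * eg) ^+ 2 = eH / 9.
    by rewrite thE; field; rewrite gt_eqF.
  by lra.
have rc : th * r <= c.
  rewrite ler_wpM2l ?(ltW th0)//; apply: (le_trans rle).
  have -> : 2 * eH ^+ 3 / (9 * M ^+ 2) = 2 / 9 / M ^+ 2 * eH ^+ 3.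
    by field; rewrite gt_eqF.
  have -> : 2 / 9 * a ^+ 3 / M ^+ 2 = 2 / 9 / M ^+ 2 * a ^+ 3.
    by field; rewrite gt_eqF.
  rewrite ler_wpM2l ?divr_ge0 ?sqr_ge0//.
  by rewrite ler_pXn2r ?nnegrE ?(ltW eH0) ?(ltW a0).
by lra.
Qed.

(** * Fair signs independent of the history *)

(** Only the coordinates of [X] are known to be measurable. The preimage of an open ray under [F] is
    open, hence a countable union of boxes with rational centre and radius [1 / (n + 1)], and a ball
    of the max norm is a finite intersection of coordinate conditions. *)
Lemma measurable_fun_continuous_comp (R : realType) (d : nat)
    (disp : measure_display) (T : measurableType disp) (X : T -> 'cV[R]_d)
    (F : 'cV[R]_d -> R) :
  continuous F -> (forall i, measurable_fun setT (fun w => X w i 0)) ->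
  measurable_fun setT (F \o X).
Proof.
move=> /continuousP cF mX; apply: (measurability _ (RGenOInfty.measurableE R)).
move=> _ [_ [a ->] <-]; rewrite setTI comp_preimage.
set A := F @^-1` _; have oA : open A by exact/cF/rray_open.
pose box (q : 'cV[rat]_d * nat) : set 'cV[R]_d :=
  ball (map_mx ratr q.1 : 'cV[R]_d) q.2.+1%:R^-1.
rewrite [X in measurable X](_ : _ = \bigcup_q
    (if `[< box q `<=` A >] then X @^-1` box q else set0)); last first.
  apply/seteqP; split=> [w Aw|w [q _]]; last by case: asboolP => // qA /qA.
  have /nbhs_ballP[e /= e0 eA] : nbhs (X w) A by apply: open_nbhs_nbhs; split.
  (* With radius below [e / 2], a box containing [X w] stays inside the ball of radius [e] around
     [X w]. *)
  have [n ne] : exists n : nat, n.+1%:R^-1 < e / 2.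
    have e20 : 0 < e / 2 by rewrite divr_gt0.
    have [n _ /(_ n (leqnn n))] := near_infty_natSinv_lt (PosNum e20).
    by exists n.
  have n0 : 0 < n.+1%:R^-1 :> R by rewrite invr_gt0.
  have /fin_all_exists[q qX] : forall i, exists q : rat,
      `|ratr q - X w i 0| < n.+1%:R^-1.
    move=> i; have : X w i 0 - n.+1%:R^-1 < X w i 0 + n.+1%:R^-1.
      by rewrite ltrBlDr -addrA ltrDl addr_gt0.
    move=> /rat_in_itvoo[q]; rewrite inE/= => /andP[].
    rewrite !bnd_simp => q1 q2.
    exists q; rewrite ltr_norml; apply/andP; split.
        by rewrite ltrBrDl.
      by rewrite ltrBlDl.
  exists (\col_i q i, n) => //.
  have wq : box (\col_i q i, n) (X w).
    by split => //= i j; rewrite ord1 !mxE; exact: qX.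
  case: asboolP => // -[y qy]; apply: eA.
  have {e0}-> : e = e / 2 + e / 2 by rewrite -splitr.
  apply: (@ball_triangle _ _ (map_mx ratr (\col_i q i) : 'cV[R]_d)).
    by apply: ball_sym; apply: le_ball wq; exact: ltW.
  by apply: le_ball qy; exact: ltW.
apply: countable_bigcupT_measurable; first exact: countableP.
move=> q; case: asboolP => // _.
rewrite [X in measurable X](_ : _ = \bigcap_(i in [set: 'I_d])
    (fun w => X w i 0) @^-1` ball (ratr (q.1 i 0) : R) q.2.+1%:R^-1).
  apply: fin_bigcap_measurable => // i _.
  by rewrite -[X in measurable X]setTI; apply: mX => //; exact: measurable_ball.
apply/seteqP; split=> w /=.
  by move=> [_ H] i _; have := H i 0; rewrite mxE.
move=> H; split; first by rewrite /= invr_gt0.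
by move=> i j; rewrite ord1 mxE; exact: H.
Qed.

Section History.
Context (R : realType) (d : nat) (disp : measure_display)
  (T : measurableType disp) (tr : trajectory R d T) (k : nat).

(** The outcome space retyped with the history as its sigma-algebra, so that being determined by the
    history is measurability of a function on this type. *)
Definition history_type := g_sigma_algebraType
  (\bigcup_(h in generated_before tr k) preimage_set_system setT h measurable).

Lemma measurable_fun_history (h : T -> R) :
  generated_before tr k h -> measurable_fun setT (h : history_type -> R).
Proof.
move=> gh _ B mB; rewrite setTI; apply: sub_gen_smallest.
by exists h => //; exists B => //; rewrite setTI.
Qed.

Lemma measurable_to_history :
  measurable_trajectory tr -> measurable_fun setT (id : T -> history_type).
Proof.
move=> mtr _ A hA; rewrite setTI.
apply: (smallest_sub (@sigma_algebra_measurable _ T) _ hA).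
by move=> _ [h gh [B mB <-]]; exact: (mtr k h gh).
Qed.

Lemma integral_fair_sign (P : probability T R) (s : R) (Y : T -> \bar R) :
  measurable_trajectory tr -> fair_independent_signs P tr ->
  s = 1 \/ s = - 1 ->
  measurable_fun setT (Y : history_type -> \bar R) ->
  (forall w, 0 <= Y w)%E ->
  (\int[P]_(w in sign tr k @^-1` [set s]) Y w =
     (2^-1)%:E * \int[P]_w Y w)%E.
Proof.
move=> mtr fair s1 mY Y0.
have mid := measurable_to_history mtr.
have mYT : measurable_fun setT Y by exact: (measurableT_comp mY mid).
set S := sign tr k @^-1` [set s].
have mS : measurable S.
  (* The [k]-th sign belongs to what is generated before index [k.+1], not before [k]. *)
  rewrite -[S]setTI; have := mtr k.+1 _ (Gen_sign tr (ltnSn k)); exact.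
have PS : P S = (2^-1)%:E.
  by have [_ P1 PN1 _] := fair k; case: s1 @S mS => ->.
have half0 : 0 <= 2^-1 :> R by [].
(* The restriction of [P] to [S] gives no mass to the complement of [S]. *)
have splitS : (\int[mrestr P mS]_w Y w = \int[P]_(w in S) Y w)%E.
  rewrite -(setvU S) ge0_integral_setU//; last 3 first.
  - exact: measurableC.
  - exact: measurable_funS mYT.
  - by apply/disj_setPS => w [].
  rewrite (eq_measure_integral mzero) ?integral_measure_zero ?add0e; last first.
    move=> A mA AS; rewrite /= /mrestr /mzero (_ : A `&` S = set0) ?measure0//.
    by apply/seteqP; split => // w [/AS].
  by apply: eq_measure_integral => A mA AS; rewrite /= /mrestr setIidl.
have pushE (mu : {measure set T -> \bar R}) :
    (\int[mu]_w Y w =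
     \int[pushforward mu (id : T -> history_type)]_y
       (Y : history_type -> _) y)%E.
  by rewrite (ge0_integral_pushforward mid)// => y _; exact: Y0.
(* By independence, the restriction of [P] to [S] and [P] scaled by 1/2 have
   the same image on the history. *)
rewrite -splitS !pushE -(ge0_integral_mscale _ _ (NngNum half0))//.
apply: eq_measure_integral => A hA _.
rewrite /= /mscale /pushforward /mrestr /=.
have [_ _ _ indep] := fair k.
by rewrite (indep A [set s] hA)//; rewrite -/S PS muleC.
Qed.

(** One averaging step without conditional expectations: [W] may depend on the [k]-th sign, but on
    each sign event it lies below a function of the history, whose integral there is half of its
    full integral. *)
Lemma le_integral_fair_sign (P : probability T R) (W V D1 DN1 : T -> R) :
  measurable_trajectory tr -> fair_independent_signs P tr ->
  measurable_fun setT W -> measurable_fun setT V ->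
  measurable_fun setT (D1 : history_type -> R) ->
  measurable_fun setT (DN1 : history_type -> R) ->
  (forall w, 0 <= W w) -> (forall w, 0 <= D1 w) -> (forall w, 0 <= DN1 w) ->
  (forall w, sign tr k w = 1 -> W w <= D1 w) ->
  (forall w, sign tr k w = - 1 -> W w <= DN1 w) ->
  (forall w, D1 w + DN1 w <= 2 * V w) ->
  (\int[P]_w (W w)%:E <= \int[P]_w (V w)%:E)%E.
Proof.
move=> mtr fair mW mV mD1 mDN1 W0 D10 DN10 WD1 WDN1 DV.
have mid := measurable_to_history mtr.
have mS s : measurable (sign tr k @^-1` [set s]).
  rewrite -[X in measurable X]setTI.
  by have := mtr k.+1 _ (Gen_sign tr (ltnSn k)); exact.
have mD1T : measurable_fun setT D1 by exact: (measurableT_comp mD1 mid).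
have mDN1T : measurable_fun setT DN1 by exact: (measurableT_comp mDN1 mid).
have signU : sign tr k @^-1` [set 1] `|` sign tr k @^-1` [set (- 1)] = setT.
  by apply/seteqP; split => // w _; have [/(_ w) sw _ _ _] := fair k.
rewrite -[in leLHS]signU ge0_integral_setU//; last 3 first.
- by apply/measurable_EFinP; exact: measurable_funS mW.
- by move=> w _; rewrite lee_fin.
- by apply/disj_setPS => w [/= -> /eqP]; rewrite eq_sym eqNr oner_eq0.
have leS s (D : T -> R) : measurable_fun setT D ->
    (forall w, sign tr k w = s -> W w <= D w) ->
    (\int[P]_(w in sign tr k @^-1` [set s]) (W w)%:E <=
     \int[P]_(w in sign tr k @^-1` [set s]) (D w)%:E)%E.
  move=> mD WD; apply: ge0_le_integral => //.
  - by move=> w _; rewrite lee_fin.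
  - by apply/measurable_EFinP; exact: measurable_funTS.
  - by apply/measurable_EFinP; exact: measurable_funTS.
apply: (le_trans (leeD (leS _ _ mD1T WD1) (leS _ _ mDN1T WDN1))).
rewrite !integral_fair_sign//; try by [left|right|apply/measurable_EFinP].
rewrite -!ge0_integralZl_EFin//; try by
  [move=> w _; rewrite lee_fin|apply/measurable_EFinP].
rewrite -ge0_integralD//; try by
  [move=> w _; rewrite ?mule_ge0 ?lee_fin|
   apply: measurable_funeM; apply/measurable_EFinP].
apply: ge0_le_integral => //.
- by move=> w _; rewrite adde_ge0// mule_ge0 ?lee_fin.
- by apply: emeasurable_funD; apply: measurable_funeM; apply/measurable_EFinP.
- exact/measurable_EFinP.
- by move=> w _; rewrite -!EFinM -EFinD lee_fin; have := DV w; lra.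
Qed.
End History.

(** * The exponential supermartingale *)

Lemma reachedS (R : realType) (d : nat) (T : Type) (tr : trajectory R d T)
    (eg eH : R) (k : nat) (w : T) :
  reached tr eg eH k.+1 w <-> reached tr eg eH k w /\ ~~ stops tr eg eH k w.
Proof.
split=> [H|[H sk] j].
  by split; [move=> j jk; apply: H; exact: ltnW|exact: H].
by rewrite ltnS leq_eqVlt => /predU1P[->//|]; exact: H.
Qed.

Lemma asbool_reachedS (R : realType) (d : nat) (T : Type)
    (tr : trajectory R d T) (eg eH : R) (k : nat) (w : T) :
  `[< reached tr eg eH k.+1 w >] =
  `[< reached tr eg eH k w >] && ~~ stops tr eg eH k w.
Proof.
apply/asboolP/andP => [/reachedS[H ?]|[/asboolP H ?]].
  by split=> //; exact/asboolP.
exact/reachedS.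
Qed.

Lemma not_stops (R : realType) (d : nat) (T : Type) (tr : trajectory R d T)
    (eg eH : R) (k : nat) (w : T) :
  ~~ stops tr eg eH k w =
  gradient_step tr eg k w || curvature_step tr eg eH k w.
Proof. by rewrite /stops negb_and !negbK. Qed.

Section TrajectoryMeasurability.
Context (R : realType) (d : nat) (disp : measure_display)
  (T : measurableType disp) (tr : trajectory R d T) (eg eH : R) (k : nat).
Context (mtr : forall h, generated_before tr k h -> measurable_fun setT h).

(** In this section the sigma-algebra on [T] is arbitrary and measurability is assumed at the single
    index [k], so the lemmas serve both the ambient space and [history_type]. *)
Lemma measurable_gradient_step (i : nat) : (i <= k)%N ->
  measurable_fun setT (gradient_step tr eg i).
Proof.
move=> ik; apply: measurable_fun_ltr => //.
apply: measurableT_comp.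
  by apply: continuous_measurable_fun; exact: sqrt_continuous.
apply: measurable_sum => a; apply: measurable_funX.
exact/mtr/Gen_grad.
Qed.

Lemma measurable_curvature_step (i : nat) : (i <= k)%N ->
  measurable_fun setT (curvature_step tr eg eH i).
Proof.
move=> ik; apply: measurable_and.
  by apply: measurable_neg; exact: measurable_gradient_step.
by apply: measurable_fun_ltr => //; exact/mtr/Gen_lambda_hat.
Qed.

Lemma measurable_stops (i : nat) : (i <= k)%N ->
  measurable_fun setT (stops tr eg eH i).
Proof.
move=> ik; apply: measurable_and; apply: measurable_neg.
  exact: measurable_gradient_step.
exact: measurable_curvature_step.
Qed.

(** Reaching [i] depends only on the tests at indices below [i], hence the range up to [k.+1]:
    whether the next iteration is reached is known before the [k]-th sign is drawn. *)
Lemma measurable_reached (i : nat) : (i <= k.+1)%N ->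
  measurable_fun setT (fun w => `[< reached tr eg eH i w >]).
Proof.
elim: i => [_|i IH ik].
  rewrite (_ : (fun w => _) = cst true) //.
  by apply/funext => w; apply/asboolP.
rewrite (_ : (fun w => _) = fun w =>
    `[< reached tr eg eH i w >] && ~~ stops tr eg eH i w); last first.
  by apply/funext => w; rewrite asbool_reachedS.
apply: measurable_and; first by apply: IH; exact: ltnW.
by apply: measurable_neg; exact: measurable_stops.
Qed.

Lemma measurable_continuous_iterate (F : 'cV[R]_d -> R) :
  continuous F -> measurable_fun setT (fun w => F (iterate tr k w)).
Proof.
move=> cF; apply: measurable_fun_continuous_comp cF _ => i.
exact/mtr/Gen_iterate.
Qed.

Lemma measurable_gradient_dot (f : 'cV[R]_d -> R) :
  twice_differentiable f ->
  measurable_fun setT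
    (fun w => dot (gradient f (iterate tr k w)) (eigvec_oracle tr k w)).
Proof.
move=> [_ dg]; apply: measurable_sum => i; apply: measurable_funM.
  apply: (measurable_continuous_iterate (F := fun x => gradient f x i 0)) => x.
  apply: differentiable_continuous.
  by apply: differentiable_comp (differentiable_coord _ _ _); exact: dg.
exact/mtr/Gen_eigvec.
Qed.

End TrajectoryMeasurability.

Section Supermartingale.
Context (R : realType) (d : nat) (f : 'cV[R]_d -> R) (x0 : 'cV[R]_d)
  (L M fbar eg eH : R).
Context (L0 : 0 < L) (M0 : 0 < M) (eg0 : 0 < eg) (eH0 : 0 < eH)
  (f2 : twice_differentiable f) (fL : lipschitz_gradient f L)
  (fM : lipschitz_hessian f M) (f_ge : forall x, fbar <= f x).
Context (disp : measure_display) (T : measurableType disp)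
  (P : probability T R) (tr : trajectory R d T).
Context (mtr : measurable_trajectory tr) (fair : fair_independent_signs P tr)
  (alg : follows_algorithm tr eg eH x0 L M)
  (orc : inexact_oracles tr eg eH f).
Context (r : R) (r0 : 0 <= r) (rg : r <= eg ^+ 2 / (6 * L))
  (rH : r <= 2 * eH ^+ 3 / (9 * M ^+ 2)).

Let th : R := eH / (128 * eg ^+ 2).
Let q : R := expR (- (th * r / 2)).
Let slope k w : R :=
  2 * stepsize tr k w / M *
  dot (gradient f (iterate tr k w)) (eigvec_oracle tr k w).

Definition potential (k : nat) (w : T) : R :=
  if `[< reached tr eg eH k w >] then expR (th * (f (iterate tr k w) - fbar))
  else 0.

(* Bound on the next potential when the k-th sign is [s]. *)
Definition next_potential_bound (s : R) (k : nat) (w : T) : R :=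
  if `[< reached tr eg eH k.+1 w >] then
    if gradient_step tr eg k w then
      q * expR (th * (f (iterate tr k w) - fbar))
    else expR (th * (f (iterate tr k w) - fbar + s * slope k w
                     - 2 / 9 * stepsize tr k w ^+ 3 / M ^+ 2))
  else 0.

Let th_gt0 : 0 < th.
Proof. by rewrite divr_gt0 ?mulr_gt0 ?exprn_gt0. Qed.

Lemma gradient_step_potential k w : reached tr eg eH k w ->
  gradient_step tr eg k w -> f (iterate tr k.+1 w) <= f (iterate tr k w) - r.
Proof.
move=> rk gk; have [/(_ gk) -> _] := alg.2 k w rk.
have [err _] := orc rk.
apply: le_trans (gradient_step_decrease f2 fL L0 eg0 err gk) _.
by rewrite lerD2l lerN2.
Qed.

Lemma potentialS_le k w :
  potential k.+1 w <= next_potential_bound (sign tr k w) k w.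
Proof.
rewrite /potential /next_potential_bound; case: asboolP => // /reachedS[rk].
have sgn : sign tr k w = 1 \/ sign tr k w = - 1.
  by have [+ _ _ _] := fair k; apply.
rewrite not_stops; case: ifP => [gk _|gk /= ck].
  rewrite -expRD ler_expR.
  have := ler_wpM2l (ltW th_gt0) (gradient_step_potential rk gk).
  have : 0 <= th * r by rewrite mulr_ge0// ltW.
  by lra.
have [_ /(_ ck) ->] := alg.2 k w rk.
have [_] := orc rk; rewrite gk => /(_ isT)[_ p1 errH _].
move: (ck) => /andP[_ lamH].
rewrite ler_expR; apply: ler_wpM2l; first exact: ltW.
have := curvature_step_le f2 fM M0 eH0 p1 errH lamH sgn.
by rewrite /slope /stepsize /lambda_hat/=; lra.
Qed.

Lemma next_potential_bound_ge0 s k w : 0 <= next_potential_bound s k w.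
Proof.
by rewrite /next_potential_bound; case: ifP => // _; case: ifP => _;
  rewrite ?mulr_ge0 ?expR_ge0.
Qed.

(** After stopping both terms are 0, at a gradient step both carry the factor [q], and at a
    curvature step [curvature_step_mgf] applies. *)
Lemma next_potential_bound_mean k w :
  next_potential_bound 1 k w + next_potential_bound (- 1) k w <=
  2 * (q * potential k w).
Proof.
rewrite /potential /next_potential_bound asbool_reachedS.
case: asboolP => /= [rk|_]; last by rewrite mulr0 mulr0 addr0.
have e0 : 0 <= q * expR (th * (f (iterate tr k w) - fbar)).
  by rewrite mulr_ge0 ?expR_ge0.
rewrite not_stops; case: ifPn => [nstop|_]; last by rewrite addr0; lra.
case: ifP => [_|gk]; first by rewrite mulr2n mulrDl mul1r.
move: nstop; rewrite gk /= => ck.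
have [err] := orc rk; rewrite gk => /(_ isT)[_ p1 errH _].
have eHa : eH <= stepsize tr k w.
  move: ck => /andP[_ /ltW lamH].
  by rewrite /stepsize -normrN (le_trans _ (ler_norm _))// lerNr.
have geg : enorm (grad_oracle tr k w) <= eg by rewrite leNgt; exact/negbT.
have yle := gradient_dot_le err geg p1.
exact: (curvature_step_mgf _ M0 eg0 eH0 eHa yle rH erefl).
Qed.

Let continuous_f : continuous f.
Proof. by move=> x; apply: differentiable_continuous; exact: f2.1. Qed.

Lemma measurable_potential k : measurable_fun setT (potential k).
Proof.
have mk := @mtr k.
apply: measurable_fun_ifT => //; first exact: measurable_reached mk _ _.
apply: measurableT_comp => //; apply: measurable_funM => //.
by apply: measurable_funB => //; exact: measurable_continuous_iterate.
Qed.

Lemma measurable_next_potential_bound s k :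
  measurable_fun setT (next_potential_bound s k : history_type tr k -> R).
Proof.
have mk := @measurable_fun_history R d disp T tr k.
(* The same trajectory viewed on the history space. All ingredients are history-measurable because
   the random sign has been replaced by the constant [s]. *)
pose trH : trajectory R d (history_type tr k) := tr.
have mf : measurable_fun setT
    (fun w : history_type tr k => f (iterate tr k w) - fbar).
  apply: measurable_funB => //.
  exact: (@measurable_continuous_iterate _ _ _ _ trH k mk).
have mstep : measurable_fun setT (stepsize tr k : history_type tr k -> R).
  exact: (mk _ (Gen_stepsize tr (leqnn k))).
apply: measurable_fun_ifT => //.
- exact: (@measurable_reached _ _ _ _ trH eg eH k mk k.+1).
- apply: measurable_fun_ifT.
  + exact: (@measurable_gradient_step _ _ _ _ trH eg k mk k).
  + apply: measurable_funM => //; apply: measurableT_comp => //.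
    exact: measurable_funM.
  + apply: measurableT_comp => //; apply: measurable_funM => //.
    apply: measurable_funB; last first.
      apply: measurable_funM => //; apply: measurable_funM => //.
      exact: measurable_funX.
    apply: measurable_funD => //; apply: measurable_funM => //.
    apply: measurable_funM; last first.
      exact: (@measurable_gradient_dot _ _ _ _ trH k mk).
    by apply: measurable_funM => //; exact: measurable_funM.
Qed.

Lemma potential_ge0 k w : 0 <= potential k w.
Proof. by rewrite /potential; case: ifP => // _; exact: expR_ge0. Qed.

Lemma integral_potential_le k :
  (\int[P]_w (potential k w)%:E <=
    (expR (th * (f x0 - fbar)) * q ^+ k)%:E)%E.
Proof.
elim: k => [|k IH].
  rewrite expr0 mulr1 (eq_integral (cst (expR (th * (f x0 - fbar)))%:E)).
    rewrite integral_cst// -[leRHS]mule1; apply: lee_wpmul2l.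
      by rewrite lee_fin expR_ge0.
    exact: probability_le1.
  move=> w _; rewrite /potential alg.1; by case: asboolP => // -[].
apply: (@le_trans _ _ (\int[P]_w (q * potential k w)%:E)%E).
  apply: (le_integral_fair_sign mtr fair
    (D1 := next_potential_bound 1 k) (DN1 := next_potential_bound (- 1) k)).
  - exact: measurable_potential.
  - by apply: measurable_funM => //; exact: measurable_potential.
  - exact: measurable_next_potential_bound.
  - exact: measurable_next_potential_bound.
  - exact: potential_ge0.
  - exact: next_potential_bound_ge0.
  - exact: next_potential_bound_ge0.
  - by move=> w <-; exact: potentialS_le.
  - by move=> w <-; exact: potentialS_le.
  - exact: next_potential_bound_mean.
under eq_integral do rewrite EFinM.
rewrite ge0_integralZl_EFin ?expR_ge0//; last 2 first.
- by move=> w _; rewrite lee_fin potential_ge0.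
- by apply/measurable_EFinP; exact: measurable_potential.
rewrite exprS mulrCA EFinM; apply: lee_wpmul2l => //.
by rewrite lee_fin expR_ge0.
Qed.

Lemma measurable_reached_set k : measurable [set w | reached tr eg eH k w].
Proof.
rewrite (_ : [set _ | _] =
    (fun w => `[< reached tr eg eH k w >]) @^-1` [set true]).
  rewrite -[X in measurable X]setTI.
  by apply: (@measurable_reached _ _ _ _ tr eg eH k (@mtr k) k (leqnSn k)).
by apply/seteqP; split => w /= /asboolP.
Qed.

(** Markov's inequality: [f] stays above [fbar], so the potential is at least 1 wherever iteration
    [k] is reached. *)
Lemma probability_reached_le k :
  (P [set w | reached tr eg eH k w] <=
    (expR (th * (f x0 - fbar) - k%:R * (th * r / 2)))%:E)%E.
Proof.
have -> : expR (th * (f x0 - fbar) - k%:R * (th * r / 2)) =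
    expR (th * (f x0 - fbar)) * q ^+ k.
  by rewrite -expRM_natl -expRD mulrN.
apply: le_trans (integral_potential_le k).
have mk := measurable_reached_set k.
rewrite -(setIT [set w | _]) -integral_indic//.
apply: ge0_le_integral => //.
- by apply/measurable_EFinP; exact: measurable_indic.
- by apply/measurable_EFinP; exact: measurable_potential.
move=> w _; rewrite lee_fin indicE /potential.
have -> : (w \in [set w | reached tr eg eH k w]) =
  `[< reached tr eg eH k w >] by [].
case: asboolP => // _; rewrite -[leLHS]expR0 ler_expR mulr_ge0 ?(ltW th_gt0)//.
by rewrite subr_ge0.
Qed.

Lemma curvature_stepsize_bounds k w : reached tr eg eH k w ->
  curvature_step tr eg eH k w -> eH <= stepsize tr k w <= 2 * L.
Proof.
move=> rk ck; have [ngk lamH] := andP ck.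
have [_ /(_ ngk)[_ p1 errH _]] := orc rk.
apply/andP; split; last first.
  exact: (curvature_stepsize_le f2 fL L0 eH0 p1 errH lamH).
by rewrite /stepsize -normrN (le_trans _ (ler_norm _))// lerNr ltW.
Qed.

(** A curvature step would force [eH <= 2 * L], so all steps are gradient steps and their decreases
    of at least [r] add up. *)
Lemma reached_no_curvature k w : 2 * L < eH ->
  reached tr eg eH k w -> k%:R * r <= f x0 - fbar.
Proof.
move=> LH rk; rewrite lerBrDr.
apply: (@le_trans _ _ (k%:R * r + f (iterate tr k w))).
  by rewrite lerD2l; exact: f_ge.
elim: k rk => [_|k IH /reachedS[rk]]; first by rewrite mul0r add0r alg.1.
rewrite not_stops => /orP[gk|ck].
  rewrite -natr1 mulrDl mul1r.
  by have := gradient_step_potential rk gk; have := IH rk; lra.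
by have := curvature_stepsize_bounds rk ck; lra.
Qed.

(** The bound [n] is real: an index is at most [n] exactly when it is below [(Num.truncn n).+1], so
    failing to terminate by [n] means reaching that index. *)
Lemma terminates_by_setE (n : R) : 0 <= n ->
  [set w | exists k : nat, k%:R <= n /\ terminates_at tr eg eH k w] =
  ~` [set w | reached tr eg eH (Num.truncn n).+1 w].
Proof.
move=> n0; apply/seteqP; split => w /=.
  move=> [k [kn [_ sk]]] /(_ k); rewrite ltnS truncn_ge_nat// => /(_ kn).
  by rewrite sk.
move=> nr; have ex : exists j, (j < (Num.truncn n).+1)%N && stops tr eg eH j w.
  apply: contrapT => H; apply: nr => j jn; apply/negP => sj; apply: H.
  by exists j; rewrite jn.
(* The least stopping index is the one that is also reached. *)
have [j /andP[jn sj] jmin] := ex_minnP ex.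
exists j; split; first by rewrite -truncn_ge_nat// -ltnS.
split=> // i ij; apply/negP => si.
by have := jmin i; rewrite si (ltn_trans ij jn) leqNgt ij => /(_ isT).
Qed.

Lemma termination_probability_ge (n delta : R) : 0 < r -> 0 <= n -> 0 < delta ->
  f x0 - fbar <= n * r ->
  (eH <= 2 * L -> th * (f x0 - fbar) - ln delta <= n * (th * r / 2)) ->
  ((1 - delta)%:E <=
    P [set w | exists k : nat, (k%:R <= n)%R /\ terminates_at tr eg eH k w])%E.
Proof.
move=> r_gt0 n0 delta0 gapn expn; rewrite terminates_by_setE//.
set N := (Num.truncn n).+1.
have nN : n < N%:R by have /andP[] := truncn_itv n0.
rewrite probability_setC; last exact: measurable_reached_set.
rewrite EFinB; apply: leeB => //.
have [HL|LH] := leP eH (2 * L).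
  apply: (le_trans (probability_reached_le N)); rewrite lee_fin.
  rewrite -[leRHS]lnK ?posrE// ler_expR.
  have : 0 < th * r / 2 by rewrite divr_gt0// mulr_gt0// th_gt0.
  move=> /ltW/ler_wpM2r => /(_ _ _ (ltW nN)).
  by have := expn HL; lra.
(* For [eH > 2 * L] the event is empty: [N] decreases of size [r] would exceed the gap, as
   [n < N]. *)
rewrite (_ : [set w | _] = set0) ?measure0 ?lee_fin ?ltW//.
apply/seteqP; split => // w /= /(reached_no_curvature LH).
rewrite leNgt => /negP; apply; apply: (le_lt_trans gapn).
by rewrite ltr_pM2r.
Qed.

End Supermartingale.

(** * The iteration bound *)

Lemma decrease_bound_gt0 (R : realType) (L M eg eH : R) :
  0 < L -> 0 < M -> 0 < eg -> 0 < eH -> 0 < decrease_bound L M eg eH.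
Proof.
move=> L0 M0 eg0 eH0; rewrite /decrease_bound lt_min.
by rewrite !divr_gt0 ?mulr_gt0 ?exprn_gt0.
Qed.

(** After substituting [eps = eH ^+ 2 / M] the product depends only on [L / eH], which is at least
    1/2. The two cases are the two entries of the minimum in [decrease_bound], the gradient entry
    first. *)
Lemma BC_decrease_ge (R : realType) (L M eps eH : R) :
  0 < L -> 0 < M -> 0 < eps -> 0 < eH -> eH ^+ 2 = eps * M -> eH <= 2 * L ->
  1 <= B_const L M (2 * L) eps * C_const M (2 * L) eps eH *
       (eH / (128 * eps ^+ 2) * decrease_bound L M eps eH / 2).
Proof.
move=> L0 M0 eps0 eH0 eH2 HL.
have M_neq0 : M != 0 by rewrite gt_eqF.
have eH_neq0 : eH != 0 by rewrite gt_eqF.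
have L_neq0 : L != 0 by rewrite gt_eqF.
have epsE : eps = eH ^+ 2 / M by rewrite eH2 mulfK.
have t1 : 1 <= 2 * L / eH by rewrite ler_pdivlMr ?mul1r.
have t3 : 1 <= (2 * L / eH) ^+ 3 by rewrite exprn_ege1.
have t2 : 1 <= (2 * L / eH) ^+ 2 by rewrite exprn_ege1.
rewrite /decrease_bound /B_const /C_const epsE /Order.min; case: ifP => _.
  rewrite [leRHS](_ : _ = 6 * (L / eH)
     + 27 * (2 * L / eH) ^+ 3); last by field; apply/and3P; split.
  have : 0 <= 6 * (L / eH).
    by rewrite mulr_ge0// divr_ge0 ?(ltW L0) ?(ltW eH0).
  by lra.
rewrite [leRHS](_ : _ =
    (1 + 36 * (L / eH) ^+ 2) * (2 * (2 * L / eH) ^+ 2)); last first.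
  by field; apply/andP; split.
have : 0 <= 36 * (L / eH) ^+ 2 by rewrite mulr_ge0// sqr_ge0.
by nra.
Qed.

Lemma B_const_gt0 (R : realType) (L M alpha eps : R) :
  0 < L -> 0 < M -> 0 < eps -> 0 < alpha -> 0 < B_const L M alpha eps.
Proof. by move=> *; rewrite /B_const addr_gt0// divr_gt0 ?mulr_gt0. Qed.

Lemma C_const_gt0 (R : realType) (M alpha eps eH : R) :
  0 < M -> 0 < alpha -> 0 < eps -> 0 < eH -> 0 < C_const M alpha eps eH.
Proof.
move=> M0 a0 e0 h0; apply: mulr_gt0; first by rewrite ltr0n.
by rewrite divr_gt0 ?mulr_gt0 ?exprn_gt0.
Qed.

(** The two summands of [n] pay for separate terms: [2 * (gap / r)] steps pay exactly [th * gap],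
    and the [B * K] steps pay [- ln delta], since [K] is [C] times a maximum
    [m >= ln (1 / delta)]. *)
Lemma iteration_bound_suffices (R : realType) (L M gap delta eps eH : R) :
  let r := decrease_bound L M eps eH in
  let n := iteration_bound L M (2 * L) gap delta eps eH in
  let th := eH / (128 * eps ^+ 2) in
  0 < L -> 0 < M -> 0 < eps -> 0 < eH -> eH ^+ 2 = eps * M ->
  0 <= gap -> 0 < delta -> delta < 1 ->
  [/\ 0 <= n, gap <= n * r &
      eH <= 2 * L -> th * gap - ln delta <= n * (th * r / 2)].
Proof.
move=> r n th L0 M0 eps0 eH0 eH2 gap0 delta0 delta1.
have r0 : 0 < r by exact: decrease_bound_gt0.
have a0 : 0 < 2 * L by rewrite mulr_gt0.
have B0 := B_const_gt0 L0 M0 eps0 a0; have C0 := C_const_gt0 M0 a0 eps0 eH0.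
have th0 : 0 < th by rewrite divr_gt0 ?mulr_gt0 ?exprn_gt0.
have lnd : 0 <= - ln delta by rewrite oppr_ge0 ln_le0// ltW.
pose m := K_const L M (2 * L) gap delta eps eH / C_const M (2 * L) eps eH.
have mE : K_const L M (2 * L) gap delta eps eH = C_const M (2 * L) eps eH * m.
  by rewrite /m mulrCA divff ?mulr1// gt_eqF.
have dm : - ln delta <= m.
  by rewrite /m /K_const mulrC mulKf ?gt_eqF// div1r lnV ?posrE// le_max lexx.
have m0 : 0 <= m by exact: le_trans dm.
have BK0 : 0 <= B_const L M (2 * L) eps * C_const M (2 * L) eps eH * m.
  exact: mulr_ge0 (mulr_ge0 (ltW B0) (ltW C0)) m0.
have nE : n = 2 * (gap / r) +
    B_const L M (2 * L) eps * C_const M (2 * L) eps eH * m.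
  by rewrite -[B_const _ _ _ _ * _ * m]mulrA -mE.
have gr : gap / r * r = gap by rewrite divfK// gt_eqF.
have gr0 : 0 <= gap / r by rewrite divr_ge0// ltW.
split.
- by rewrite nE addr_ge0// mulr_ge0.
- rewrite nE mulrDl -mulrA gr; have := mulr_ge0 BK0 (ltW r0); lra.
move=> HL; rewrite nE mulrDl.
have -> : 2 * (gap / r) * (th * r / 2) = th * (gap / r * r).
  by field; rewrite gt_eqF.
rewrite gr lerD2l; apply: (le_trans dm); rewrite mulrAC ler_peMl//.
exact: BC_decrease_ge.
Qed.

Lemma bigO_at0I (R : realType) (F G : R -> R) (c e : R) :
  0 < c -> 0 < e ->
  (forall eps, 0 < eps -> eps < e -> `|F eps| <= c * `|G eps|) ->
  bigO_at0 F G.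
Proof.
move=> c0 e0 FG; apply/eqO_exP; exists c => //.
near=> x; apply: FG; near: x; [exact: nbhs_right_gt|exact: nbhs_right_lt].
Unshelve. all: by end_near. Qed.

(** A lower bound of order [eps ^+ 2], used to bound [gap / decrease_bound] from above. The
    curvature entry has order [eps] to the power 3/2, and [eps <= Num.sqrt eps] for [eps <= 1]. *)
Lemma decrease_bound_ge (R : realType) (L M eps : R) :
  0 < L -> 0 < M -> 0 < eps -> eps <= 1 ->
  Num.min (1 / (6 * L)) (2 * Num.sqrt M / (9 * M)) * eps ^+ 2 <=
  decrease_bound L M eps (Num.sqrt (eps * M)).
Proof.
move=> L0 M0 eps0 eps1.
set s := Num.min _ _; rewrite /decrease_bound le_min; apply/andP; split.
  have : s <= 1 / (6 * L) by rewrite ge_min lexx.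
  by move=> /(ler_wpM2r (sqr_ge0 eps)); lra.
have : s <= 2 * Num.sqrt M / (9 * M) by rewrite ge_min lexx orbT.
move=> /(ler_wpM2r (sqr_ge0 eps)) /le_trans; apply.
have sM : eps * Num.sqrt M <= Num.sqrt (eps * M).
  rewrite sqrtrM ?(ltW eps0)// ler_wpM2r ?sqrtr_ge0//.
  rewrite -[leLHS]sqr_sqrtr ?(ltW eps0)// expr2 ler_piMl ?sqrtr_ge0//.
  by rewrite -sqrtr1 ler_wsqrtr.
have -> : 2 * Num.sqrt (eps * M) ^+ 3 / (9 * M ^+ 2) =
    2 / (9 * M) * eps * Num.sqrt (eps * M).
  have -> : Num.sqrt (eps * M) ^+ 3 = eps * M * Num.sqrt (eps * M).
    by rewrite exprS mulrC sqr_sqrtr// mulr_ge0 ?ltW.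
  by field; rewrite gt_eqF.
have -> : 2 * Num.sqrt M / (9 * M) * eps ^+ 2 =
    2 / (9 * M) * eps * (eps * Num.sqrt M) by field; rewrite gt_eqF.
by rewrite ler_wpM2l// !mulr_ge0 ?invr_ge0 ?mulr_ge0 ?(ltW M0) ?(ltW eps0).
Qed.

Lemma C_const_sqrtE (R : realType) (L M eps : R) : 0 < M -> 0 < eps ->
  C_const M (2 * L) eps (Num.sqrt (eps * M)) = 9216 * L ^+ 2 / M * eps^-1.
Proof.
move=> M0 eps0; rewrite /C_const.
have -> : Num.sqrt (eps * M) ^+ 6 = (eps * M) ^+ 3.
  by rewrite (exprM _ 2 3) sqr_sqrtr// mulr_ge0 ?ltW.
by field; rewrite !gt_eqF.
Qed.

(** For [eps] below [expR (- 1)] one has [|ln eps| >= 1], so the constant [ln A] is absorbed into a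
    multiple of [|ln eps|]. *)
Lemma ln_le_norm_ln (R : realType) (A y eps : R) :
  1 <= A -> 0 <= y -> 0 < eps -> eps < expR (- 1) ->
  y <= A * eps ^- 2 -> ln y <= (ln A + 2) * `|ln eps|.
Proof.
move=> A1 y0 eps0 epse yA.
have lneps : ln eps <= - 1 by rewrite -ler_expR lnK ?posrE// ltW.
have lnA := ln_ge0 A1.
rewrite ler0_norm; last by lra.
(* The case [y = 0] rests on the convention [ln 0 = 0]; it occurs when the gap is 0. *)
move: y0; rewrite le_eqVlt => /predU1P[<-|y0].
  by rewrite ln0// mulr_ge0; lra.
have Ap : 0 < A by lra.
apply: (@le_trans _ _ (ln (A * eps ^- 2))).
  by rewrite ler_ln// ?posrE// mulr_gt0// invr_gt0 exprn_gt0.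
rewrite lnM ?posrE ?invr_gt0 ?exprn_gt0// lnV ?posrE ?exprn_gt0// lnXn//.
by rewrite -mulr_natr; nra.
Qed.

(** * Asymptotics as eps tends to 0 *)

Section Asymptotics.
Context (R : realType) (L M gap delta : R).
Context (L0 : 0 < L) (M0 : 0 < M) (gap0 : 0 <= gap)
  (delta0 : 0 < delta) (delta1 : delta < 1).

Let eH (eps : R) : R := Num.sqrt (eps * M).
Let rate (eps : R) : R := decrease_bound L M eps (eH eps).
Let Bc (eps : R) : R := B_const L M (2 * L) eps.
Let Cc (eps : R) : R := C_const M (2 * L) eps (eH eps).
Let Kc (eps : R) : R := K_const L M (2 * L) gap delta eps (eH eps).
Let nc (eps : R) : R := iteration_bound L M (2 * L) gap delta eps (eH eps).

Let cB : R := 1 + 36 * L ^+ 2 / M.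
Let cC : R := 9216 * L ^+ 2 / M.
Let rho : R := Num.min (1 / (6 * L)) (2 * Num.sqrt M / (9 * M)).
(** The summand 1 in [A1] and [A2] keeps their logarithms nonnegative. The first three summands of
    [cM] bound the entries of the maximum in [K] other than 1, relative to [|ln eps|]. *)
Let A1 : R := 1 + 4 * (gap / rho).
Let A2 : R := 1 + 2 * cB * cC.
Let cM : R := - ln delta + (ln A1 + 2) + 2 * (ln A2 + 2) + 1.

Let cB_gt0 : 0 < cB.
Proof.
apply: ltr_wpDr => //; apply: divr_ge0; last exact: ltW.
by apply: mulr_ge0 => //; exact: sqr_ge0.
Qed.

Let cC_gt0 : 0 < cC.
Proof.
have n0 : 0 < 9216 :> R by rewrite ltr0n.
exact: divr_gt0 (mulr_gt0 n0 (exprn_gt0 2 L0)) M0.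
Qed.

Let rho_gt0 : 0 < rho.
Proof. by rewrite lt_min !divr_gt0 ?mulr_gt0 ?sqrtr_gt0. Qed.

Let A1_ge1 : 1 <= A1.
Proof.
by rewrite lerDl; apply: mulr_ge0 => //; apply: divr_ge0 => //; exact: ltW.
Qed.

Let A2_ge1 : 1 <= A2.
Proof.
by rewrite lerDl; apply: mulr_ge0; [apply: mulr_ge0|] => //; exact: ltW.
Qed.

Let lnd_ge0 : 0 <= - ln delta.
Proof. by rewrite oppr_ge0 ln_le0// ltW. Qed.

Let cM_gt0 : 0 < cM.
Proof.
have l1 := ln_ge0 A1_ge1; have l2 := ln_ge0 A2_ge1.
by apply: ltr_wpDl => //; rewrite !addr_ge0// mulr_ge0// addr_ge0.
Qed.

Let eH_gt0 (eps : R) : 0 < eps -> 0 < eH eps.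
Proof. by move=> e0; rewrite sqrtr_gt0 mulr_gt0. Qed.

Let Bc_gt0 (eps : R) : 0 < eps -> 0 < Bc eps.
Proof. by move=> e0; apply: B_const_gt0 => //; rewrite mulr_gt0. Qed.

Let Bc_le (eps : R) : 0 < eps -> eps < 1 -> Bc eps <= cB * eps^-1.
Proof.
move=> e0 e1; have ei : 1 <= eps^-1 by rewrite invf_ge1// ltW.
have -> : cB * eps^-1 = eps^-1 + 18 * (2 * L) * L / (M * eps).
  by rewrite /cB; field; rewrite !gt_eqF.
by rewrite lerD2r.
Qed.

Let CcE (eps : R) : 0 < eps -> Cc eps = cC * eps^-1.
Proof. exact: C_const_sqrtE. Qed.

Let rate_gt0 (eps : R) : 0 < eps -> 0 < rate eps.
Proof. by move=> e0; apply: decrease_bound_gt0 => //; exact: eH_gt0. Qed.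

Let gap_rate_le (eps : R) : 0 < eps -> eps < 1 ->
  gap / rate eps <= gap / rho * eps ^- 2.
Proof.
move=> e0 e1; rewrite -mulrA; apply: ler_wpM2l => //; rewrite -invfM.
have rr := decrease_bound_ge L0 M0 e0 (ltW e1).
rewrite lef_pV2// posrE; first exact: rate_gt0.
by rewrite mulr_gt0// exprn_gt0.
Qed.

Let norm_ln_ge1 (eps : R) : 0 < eps -> eps < expR (- 1) -> 1 <= `|ln eps|.
Proof.
move=> e0 ee; have : ln eps <= - 1 by rewrite -ler_expR lnK ?posrE// ltW.
move=> H; have l0 : ln eps <= 0 by apply: (le_trans H); rewrite oppr_le0.
by rewrite ler0_norm// lerNr.
Qed.

Let expRN1_lt1 : (expR (- 1) : R) < 1.
Proof. by rewrite expR_lt1 oppr_lt0. Qed.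

Let Kc_le (eps : R) : 0 < eps -> eps < expR (- 1) ->
  0 <= Kc eps <= cC * cM * (eps^-1 * `|ln eps|).
Proof.
move=> e0 ee; have e1 := lt_trans ee expRN1_lt1.
have l1 := norm_ln_ge1 e0 ee.
have lA1 := ln_ge0 A1_ge1; have lA2 := ln_ge0 A2_ge1.
have ei2 : 1 <= eps ^- 2 by rewrite invf_ge1 ?exprn_gt0// exprn_ile1 ?ltW.
have C0 : 0 < Cc eps by rewrite CcE// mulr_gt0// invr_gt0.
have t1 : ln (1 / delta) <= - ln delta * `|ln eps|.
  by rewrite div1r lnV ?posrE// ler_peMr.
have t2 : ln (4 * (gap / rate eps)) <= (ln A1 + 2) * `|ln eps|.
  apply: ln_le_norm_ln => //.
    by apply: mulr_ge0 => //; apply: divr_ge0 => //; apply/ltW/rate_gt0.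
  by have := gap_rate_le e0 e1; rewrite /A1; lra.
have t3 : ln (2 * Bc eps * Cc eps) <= (ln A2 + 2) * `|ln eps|.
  apply: ln_le_norm_ln => //.
    by apply: mulr_ge0; [apply: mulr_ge0 => //; apply/ltW/Bc_gt0|exact: ltW].
  have := ler_wpM2r (ltW C0) (Bc_le e0 e1).
  have -> : cB * eps^-1 * Cc eps = cB * cC * eps ^- 2.
    by rewrite CcE// -exprVn; ring.
  by rewrite /A2; lra.
rewrite /Kc /K_const -/(Cc eps) -/(Bc eps) -/(rate eps); apply/andP; split.
  apply: mulr_ge0; first exact: ltW.
  by rewrite !le_max ler01 !orbT.
have -> : cC * cM * (eps^-1 * `|ln eps|) = Cc eps * (cM * `|ln eps|).
  by rewrite CcE//; ring.
apply: ler_wpM2l; first exact: ltW.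
have p0 : 0 <= - ln delta * `|ln eps| by rewrite mulr_ge0.
have p1 : 0 <= (ln A1 + 2) * `|ln eps| by rewrite mulr_ge0//; lra.
have p2 : 0 <= (ln A2 + 2) * `|ln eps| by rewrite mulr_ge0//; lra.
(* Each entry of the maximum is bounded by its own summand of [cM], the others being nonnegative. *)
by rewrite !ge_max /cM; apply/and4P; split; lra.
Qed.

Lemma decrease_bound_bigO : bigO_at0 rate (fun eps => eps ^+ 2).
Proof.
apply: (@bigO_at0I _ _ _ (6 * L)^-1 1) => // [|eps e0 e1].
  by rewrite invr_gt0 mulr_gt0.
rewrite !ger0_norm ?sqr_ge0//; last by rewrite ltW// rate_gt0.
by rewrite mulrC /rate /decrease_bound ge_min lexx.
Qed.

Lemma B_const_bigO : bigO_at0 Bc (fun eps => eps^-1).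
Proof.
apply: (@bigO_at0I _ _ _ cB 1) => // eps e0 e1.
by rewrite !gtr0_norm ?invr_gt0 ?Bc_gt0// Bc_le.
Qed.

Lemma C_const_bigO : bigO_at0 Cc (fun eps => eps^-1).
Proof.
apply: (@bigO_at0I _ _ _ cC 1) => // eps e0 e1.
by rewrite CcE// normrM (gtr0_norm cC_gt0).
Qed.

Lemma K_const_softO : softO_at0 Kc (fun eps => eps^-1).
Proof.
exists 1%N; apply: (@bigO_at0I _ _ _ (cC * cM) (expR (- 1))).
- exact: mulr_gt0.
- exact: expR_gt0.
move=> eps e0 ee; have /andP[K0 KL] := Kc_le e0 ee.
rewrite expr1 ger0_norm// normrM normr_id ger0_norm//.
by rewrite invr_ge0 ltW.
Qed.

Lemma iteration_bound_softO : softO_at0 nc (fun eps => eps ^- 2).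
Proof.
exists 1%N.
apply: (@bigO_at0I _ _ _ (2 * (gap / rho) + cB * (cC * cM)) (expR (- 1))).
- apply: ltr_wpDl; last exact: mulr_gt0 cB_gt0 (mulr_gt0 cC_gt0 cM_gt0).
  by apply: mulr_ge0 => //; apply: divr_ge0 => //; exact: ltW.
- exact: expR_gt0.
move=> eps e0 ee; have /andP[K0 KL] := Kc_le e0 ee.
have e1 := lt_trans ee expRN1_lt1; have l1 := norm_ln_ge1 e0 ee.
have e2 : 0 < eps ^- 2 by rewrite invr_gt0 exprn_gt0.
have g0 : 0 <= gap / rate eps by apply: divr_ge0 => //; apply/ltW/rate_gt0.
have BK0 : 0 <= Bc eps * Kc eps by apply: mulr_ge0 => //; apply/ltW/Bc_gt0.
have nE : nc eps = 2 * (gap / rate eps) + Bc eps * Kc eps by [].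
rewrite nE expr1 normrM normr_id (gtr0_norm e2) ger0_norm; last first.
  by rewrite addr_ge0// mulr_ge0.
(* This term carries no logarithm; it fits the common bound because [|ln eps| >= 1]. *)
have tn : 2 * (gap / rate eps) <= 2 * (gap / rho) * (eps ^- 2 * `|ln eps|).
  have -> : 2 * (gap / rho) * (eps ^- 2 * `|ln eps|) =
      2 * (gap / rho * eps ^- 2 * `|ln eps|) by ring.
  apply: ler_wpM2l => //; apply: (le_trans (gap_rate_le e0 e1)).
  rewrite ler_peMr// mulr_ge0 ?(ltW e2)//.
  by apply: divr_ge0 => //; exact: ltW.
have tK : Bc eps * Kc eps <= cB * (cC * cM) * (eps ^- 2 * `|ln eps|).
  have -> : cB * (cC * cM) * (eps ^- 2 * `|ln eps|) =
      cB * eps^-1 * (cC * cM * (eps^-1 * `|ln eps|)).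
    by rewrite -exprVn; ring.
  by apply: ler_pM => //; [apply/ltW/Bc_gt0|exact: Bc_le].
by rewrite [leRHS]mulrDl; exact: lerD.
Qed.

End Asymptotics.

Theorem corollary2p13 (R : realType) (d : nat) (f : 'cV[R]_d -> R)
    (x0 : 'cV[R]_d) (L M fbar delta : R)
    (L_gt0 : 0 < L) (M_gt0 : 0 < M)
    (f_diff : twice_differentiable f)
    (f_grad : lipschitz_gradient f L)
    (f_hess : lipschitz_hessian f M)
    (f_below : forall x, fbar <= f x)
    (delta_gt0 : 0 < delta) (delta_lt1 : delta < 1) :
  let gap := f x0 - fbar in
  let alpha := 2 * L in
  let eps_H (eps : R) : R := Num.sqrt (eps * M) in
  let R_ (eps : R) := decrease_bound L M eps (eps_H eps) in
  let B (eps : R) := B_const L M alpha eps in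
  let C (eps : R) := C_const M alpha eps (eps_H eps) in
  let K (eps : R) := K_const L M alpha gap delta eps (eps_H eps) in
  let n (eps : R) := iteration_bound L M alpha gap delta eps (eps_H eps) in
  (forall eps : R, 0 < eps ->
   forall (disp : measure_display) (T : measurableType disp)
     (P : probability T R) (tr : trajectory R d T),
     measurable_trajectory tr ->
     fair_independent_signs P tr ->
     follows_algorithm tr eps (eps_H eps) x0 L M ->
     inexact_oracles tr eps (eps_H eps) f ->
     (forall k w, reached tr eps (eps_H eps) k w ->
        curvature_step tr eps (eps_H eps) k w ->
        eps_H eps <= stepsize tr k w <= Num.min alpha `|lambda_hat tr k w|) /\
     ((1 - delta)%:E <=
        P [set w | exists k : nat,
             (k%:R <= n eps)%R /\ terminates_at tr eps (eps_H eps) k w])%E) /\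
  [/\ bigO_at0 R_ (fun eps => eps ^+ 2),
      bigO_at0 B (fun eps => eps^-1),
      bigO_at0 C (fun eps => eps^-1),
      softO_at0 K (fun eps => eps^-1) &
      softO_at0 n (fun eps => eps ^- 2)].
Proof.
move=> gap alpha eH R_ B C K n.
have gap0 : 0 <= gap by rewrite subr_ge0.
split=> [eps eps0 disp T P tr mtr fair alg orc|]; last first.
  split; [exact: decrease_bound_bigO|exact: B_const_bigO|exact: C_const_bigO|
    exact: K_const_softO|exact: iteration_bound_softO].
have eH0 : 0 < eH eps by rewrite sqrtr_gt0 mulr_gt0.
have eH2 : eH eps ^+ 2 = eps * M by rewrite sqr_sqrtr// mulr_ge0 ?ltW.
have r0 := decrease_bound_gt0 L_gt0 M_gt0 eps0 eH0.
split=> [k w rk ck|].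
  have := curvature_stepsize_bounds L_gt0 eH0 f_diff f_grad orc rk ck.
  (* The stepsize is [|lambda_hat|] by definition, so the second entry of the minimum is met by
     reflexivity. *)
  by rewrite le_min lexx andbT.
have [n0 gapn expn] := iteration_bound_suffices L_gt0 M_gt0 eps0 eH0 eH2
  gap0 delta_gt0 delta_lt1.
apply: (termination_probability_ge L_gt0 M_gt0 eps0 eH0 f_diff f_grad f_hess
  f_below mtr fair alg orc (ltW r0) _ _ r0 n0 delta_gt0 gapn expn).
  by rewrite /decrease_bound ge_min lexx.
by rewrite /decrease_bound ge_min lexx orbT.
Qed.
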